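(* There exist a finite set $A$, a continuous positionally determined payoff $\varphi\colon A^\omega\to\mathbb{R}$ and an $A$-labeled game graph $G$ such that there exists no multi-discounted payoff $\psi\colon A^\omega\to\mathbb{R}$ to which $\varphi$ positionally reduces inside $G$.
   Context: $A^\omega$ denotes the set of infinite words over $A$. A payoff is a bounded function $A^\omega\to\mathbb{R}$. Continuity is with respect to the product topology on $A^\omega$ of the discrete topology on $A$. A payoff $\psi\colon A^\omega\to\mathbb{R}$ is multi-discounted if there are functions $\lambda\colon A\to[0,1)$ and $w\colon A\to\mathbb{R}$ such that $\psi(a_1a_2a_3\ldots)=\sum_{n=1}^\infty\lambda(a_1)\cdot\ldots\cdot\lambda(a_{n-1})\cdot w(a_n)$ for all $a_1a_2a_3\ldots\in A^\omega$. Positional reduction: for two payoffs $\varphi,\psi\colon A^\omega\to\mathbb{R}$ and an $A$-labeled game graph $G$, $\varphi$ positionally reduces to $\psi$ inside $G$ if any pair of positional strategies in $G$ which is an equilibrium for $\psi$ is also an equilibrium for $\varphi$. Games. An $A$-labeled game graph is a tuple $G=\langle V,V_{\mathrm{Max}},V_{\mathrm{Min}},E\rangle$ of finite sets such that $V$ is the disjoint union of $V_{\mathrm{Max}}$ and $V_{\mathrm{Min}}$, $E\subseteq V\times A\times V$, and for every $s\in V$ there exist $a\in A$, $t\in V$ with $(s,a,t)\in E$. For $e=(s,a,t)\in E$ put $\mathsf{source}(e)=s$, $\mathsf{lab}(e)=a$, $\mathsf{target}(e)=t$. A path is a non-empty finite or infinite sequence of edges in which the target of each edge is the source of the next one; moreover,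 for each $s\in V$ there is a $0$-length path $\lambda_s$ with $\mathsf{source}(\lambda_s)=\mathsf{target}(\lambda_s)=s$. The source of a path of positive length is the source of its first edge, and the target of a finite path of positive length is the target of its last edge. For a path $p$, $\mathsf{lab}(p)$ is the word of labels of its edges, in order. A strategy of Max is a mapping $\sigma$ assigning to every finite path $p$ (including $0$-length paths) with $\mathsf{target}(p)\in V_{\mathrm{Max}}$ an edge whose source is $\mathsf{target}(p)$; strategies of Min are defined analogously with $V_{\mathrm{Min}}$. An infinite path $\mathcal{P}$ is consistent with a strategy of Max $\sigma$ if for every finite prefix $p$ of $\mathcal{P}$ (including the $0$-length one) with $\mathsf{target}(p)\in V_{\mathrm{Max}}$, $\sigma(p)$ is the next edge of $\mathcal{P}$ after $p$; similarly for Min. $\mathsf{Cons}(s,\sigma)$ is the set of infinite paths starting at $s$ and consistent with $\sigma$. A strategy is positional if its value on a path $p$ depends only on $\mathsf{target}(p)$. The value (w.r.t. a payoff $\varphi$) at $s\in V$ of a strategy of Max $\sigma$ is $\mathbf{Val}[\sigma](s)=\inf\{\varphi(\mathsf{lab}(\mathcal P)) : \mathcal P\in\mathsf{Cons}(s,\sigma)\}$, and of a strategy of Min $\tau$ is $\mathbf{Val}[\tau](s)=\sup\{\varphi(\mathsf{lab}(\mathcal P)) : \mathcal P\in\mathsf{Cons}(s,\tau)\}$. A pair $(\sigma,\tau)$ of a strategy of Max and a strategy of Min is an equilibrium for $\varphi$ if $\mathbf{Val}[\sigma](s)=\mathbf{Val}[\tau](s)$ for every $s\in V$. The payoff $\varphi$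 is positionally determined if every $A$-labeled game graph has an equilibrium for $\varphi$ consisting of two positional strategies. *)

(* Defs.v *)
From mathcomp Require Import all_boot all_order all_algebra.
From mathcomp Require Import all_classical all_reals all_analysis.

Set Implicit Arguments.
Unset Strict Implicit.
Unset Printing Implicit Defensive.

Import Order.TTheory GRing.Theory Num.Theory.
Import numFieldNormedType.Exports.

Local Open Scope classical_set_scope.
Local Open Scope ring_scope.

(* The word a_1 a_2 a_3 ... is the function sending n to a_(n+1). *)
Notation word A := (prod_topology (fun _ : nat => discrete_topology A)).

Record payoff (A : finType) (R : realType) := Payoff {
  payoff_fun :> word A -> R;
  payoff_bounded : bounded_fun payoff_fun }.

Definition multi_discounted (A : finType) (R : realType) (psi : payoff A R) :=
  exists lam w : A -> R,
    (forall a, 0 <= lam a < 1) /\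
    forall u : word A,
      series (fun n => (\prod_(i < n) lam (u i)) * w (u n)) @ \oo --> psi u.

Record game_graph (A : finType) := GameGraph {
  vertex : finType;
  vmax : {set vertex};
  vmin : {set vertex};
  edges : {set vertex * A * vertex};
  vmax_vmin_cover : vmax :|: vmin = finset.setT;
  vmax_vmin_disjoint : vmax :&: vmin = finset.set0;
  edges_total : forall s, exists a t, (s, a, t) \in edges }.

Section Games.
Context {A : finType} {G : game_graph A}.

Definition edge : Type := (vertex G * A * vertex G)%type.
Definition source (e : edge) : vertex G := e.1.1.
Definition lab (e : edge) : A := e.1.2.
Definition target (e : edge) : vertex G := e.2.

(* A finite path is encoded by its source together with the sequence of its
   edges, so that (s, [::]) is the 0-length path at s. *)
Fixpoint is_path (s : vertex G) (p : seq edge) : bool :=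
  if p is e :: p' then
    [&& e \in edges G, source e == s & is_path (target e) p']
  else true.

Record fpath := FPath {
  path_source : vertex G;
  path_edges : seq edge;
  path_valid : is_path path_source path_edges }.

Definition path_target (p : fpath) : vertex G :=
  last (path_source p) (map target (path_edges p)).

Definition is_ipath (P : nat -> edge) : Prop :=
  forall n, P n \in edges G /\ target (P n) = source (P n.+1).

Definition lab_word (P : nat -> edge) : word A := fun n => lab (P n).

Definition prefix_of (p : fpath) (P : nat -> edge) : Prop :=
  path_source p = source (P 0%N) /\
  path_edges p = mkseq P (size (path_edges p)).

(* Strategies of the player who controls the vertices in S. They are total on
   finite paths, but only their values on paths ending in S are constrained
   or ever used. *)
Record strategy (S : {set vertex G}) := Strategy {
  move_of :> fpath -> edge;
  move_valid : forall p, path_target p \in S ->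
    move_of p \in edges G /\ source (move_of p) = path_target p }.

Definition positional (S : {set vertex G}) (sigma : strategy S) : Prop :=
  forall p q : fpath, path_target p \in S -> path_target p = path_target q ->
    sigma p = sigma q.

Definition consistent (S : {set vertex G}) (sigma : strategy S)
    (P : nat -> edge) : Prop :=
  forall p : fpath, prefix_of p P -> path_target p \in S ->
    sigma p = P (size (path_edges p)).

Definition Cons (S : {set vertex G}) (s : vertex G) (sigma : strategy S) :
    set (nat -> edge) :=
  [set P | [/\ is_ipath P, source (P 0%N) = s & consistent sigma P]].

Definition val_max (R : realType) (phi : payoff A R)
    (sigma : strategy (vmax G)) (s : vertex G) : R :=
  inf [set phi (lab_word P) | P in Cons s sigma].

Definition val_min (R : realType) (phi : payoff A R)
    (tau : strategy (vmin G)) (s : vertex G) : R :=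
  sup [set phi (lab_word P) | P in Cons s tau].

Definition equilibrium (R : realType) (phi : payoff A R)
    (sigma : strategy (vmax G)) (tau : strategy (vmin G)) : Prop :=
  forall s, val_max phi sigma s = val_min phi tau s.

End Games.

Definition positionally_determined (A : finType) (R : realType)
    (phi : payoff A R) : Prop :=
  forall G : game_graph A,
    exists (sigma : strategy (vmax G)) (tau : strategy (vmin G)),
      [/\ positional sigma, positional tau & equilibrium phi sigma tau].

Definition positionally_reduces (A : finType) (R : realType)
    (phi psi : payoff A R) (G : game_graph A) : Prop :=
  forall (sigma : strategy (vmax G)) (tau : strategy (vmin G)),
    positional sigma -> positional tau ->
    equilibrium psi sigma tau -> equilibrium phi sigma tau.

(* Main.v *)
(** A payoff with [phi (a u) = step a (phi u)] for monotone maps [step a] obeys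
    Bellman equations, so positional strategies that are optimal in each edge
    form an equilibrium.  If [phi] reduces to a multi-discounted [psi], then in
    a one-player graph every strict comparison of [phi] between two words
    offered at a vertex also holds for [psi].  For [psi] the letters act by
    affine maps, and the difference of two affine maps cannot have the signs
    +, -, + at three increasing points, whereas [step (inl true) - step (inl
    false)] has these signs at the values 5, 6, 7 of the constant words
    [(inr 0)^w], [(inr 1)^w], [(inr 2)^w]. *)

Require Import Defs.
From mathcomp Require Import all_boot all_order all_algebra.
From mathcomp Require Import all_classical all_reals all_analysis.
From mathcomp Require Import zify lra.
Import Order.TTheory GRing.Theory Num.Theory.
Import numFieldNormedType.Exports.
Import Defs.

Set Implicit Arguments.
Unset Strict Implicit.
Unset Printing Implicit Defensive.

Local Open Scope classical_set_scope.
Local Open Scope ring_scope.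

(** * Positional strategies and their equilibria *)

Section PositionalStrategies.
Context {A : finType} {G : game_graph A}.
Implicit Types (s : vertex G) (P : nat -> @edge A G) (f : vertex G -> @edge A G).

Lemma prefix_target (p : @fpath A G) P : is_ipath P -> prefix_of p P ->
  path_target p = source (P (size (path_edges p))).
Proof.
move=> ipP [psrc pedges]; rewrite /path_target psrc pedges size_mkseq.
case: (size _) => [//|n]; rewrite -(ipP n).2.
by rewrite /mkseq -addn1 iotaD !map_cat last_cat.
Qed.

Lemma is_path_mkseq P n : is_ipath P -> is_path (source (P 0%N)) (mkseq P n).
Proof.
elim: n P => [//|n IH] P ipP; rewrite /mkseq /= (ipP 0%N).1 eqxx /=.
rewrite (iotaDl 1 0) -map_comp (ipP 0%N).2.
exact: (IH (fun n => P n.+1)).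
Qed.

Definition valid_choice f : Prop := forall s, f s \in edges G /\ source (f s) = s.

Definition positional_strategy (S : {set vertex G}) f (vf : valid_choice f) :
    strategy S :=
  @Strategy A G S (fun p => f (path_target p)) (fun p _ => vf (path_target p)).

Lemma positional_strategyP S f vf : positional (@positional_strategy S f vf).
Proof. by move=> p q _ pq /=; rewrite pq. Qed.

(** A prefix of [P] is determined by its length [n] and ends at the source of [P n], so consistency
    becomes one condition per index. *)
Lemma Cons_positional S f vf s P : Cons s (@positional_strategy S f vf) P <->
  [/\ is_ipath P, source (P 0%N) = s &
      forall n, source (P n) \in S -> P n = f (source (P n))].
Proof.
split=> -[ipP Ps cP]; split=> //.
  move=> n; pose p := FPath (is_path_mkseq n ipP).
  have pP : prefix_of p P by split; rewrite //= size_mkseq.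
  have sp : size (path_edges p) = n by rewrite /= size_mkseq.
  by have := cP p pP; rewrite /= (prefix_target ipP pP) sp => h /h.
move=> p pP /=; rewrite (prefix_target ipP pP) => pS.
by rewrite -cP.
Qed.

Definition play f s (n : nat) : @edge A G := f (iter n (target \o f) s).

Lemma play_Cons S f vf s : Cons s (@positional_strategy S f vf) (play f s).
Proof.
apply/Cons_positional; split.
- by move=> n; rewrite /play; split; [exact: (vf _).1 | rewrite (vf _).2].
- exact: (vf _).2.
- by move=> n _; rewrite /play (vf _).2.
Qed.

(** The play in which both players follow [f] is consistent with both strategies. It therefore
    attains the supremum and the infimum as soon as they are ordered. *)
Lemma equilibriumP (R : realType) (chi : payoff A R) f (vf : valid_choice f) :
  equilibrium chi (positional_strategy (vmax G) vf)
                  (positional_strategy (vmin G) vf) <->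
  forall s P Q, Cons s (positional_strategy (vmin G) vf) P ->
    Cons s (positional_strategy (vmax G) vf) Q ->
    chi (lab_word P) <= chi (lab_word Q).
Proof.
have [M [_ chiM]] := payoff_bounded chi.
have {chiM} chiM u : `|chi u| <= M + 1 by apply: chiM => //; rewrite ltrDl.
split=> [eq s P Q cP cQ|le s].
  have h1 : chi (lab_word P) <= val_min chi (positional_strategy (vmin G) vf) s.
    apply: ub_le_sup; last by exists P.
    by exists (M + 1) => _ [u _ <-]; exact: le_trans (ler_norm _) (chiM _).
  rewrite -eq in h1; apply: le_trans h1 _.
  apply: ge_inf; last by exists Q.
  exists (- (M + 1)) => _ [u _ <-].
  by have := chiM (lab_word u); rewrite ler_norml => /andP[].
have pmax := play_Cons (vmax G) vf s.
have pmin := play_Cons (vmin G) vf s.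
transitivity (chi (lab_word (play f s))); apply/eqP; rewrite eq_le.
  apply/andP; split.
    apply: ge_inf; last by exists (play f s).
    by exists (chi (lab_word (play f s))) => _ [Q cQ <-]; exact: le cQ.
  apply: lb_le_inf; first by exists (chi (lab_word (play f s))), (play f s).
  by move=> _ [Q cQ <-]; exact: le cQ.
apply/andP; split.
  apply: ub_le_sup; last by exists (play f s).
  by exists (chi (lab_word (play f s))) => _ [P cP <-]; exact: le cP pmax.
apply: ge_sup; first by exists (chi (lab_word (play f s))), (play f s).
by move=> _ [P cP <-]; exact: le cP pmax.
Qed.

Lemma vmin_vmaxN s : (s \in vmin G) = (s \notin vmax G).
Proof.
have /setP/(_ s) := vmax_vmin_cover G; have /setP/(_ s) := vmax_vmin_disjoint G.
by rewrite !inE; case: (s \in vmax G); case: (s \in vmin G).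
Qed.

Lemma best_edges (r : @edge A G -> nat) : exists f, [/\ valid_choice f,
    forall e, e \in edges G -> source e \in vmax G -> (r e <= r (f (source e)))%N &
    forall e, e \in edges G -> source e \in vmin G -> (r (f (source e)) <= r e)%N].
Proof.
pose best s (x : @edge A G) := [/\ x \in edges G, source x = s &
  forall e, e \in edges G -> source e = s ->
  is_true (if s \in vmax G then (r e <= r x)%N else (r x <= r e)%N)].
have [f Pf] : {f & forall s, best s (f s)}.
  apply: choice => s; rewrite /best.
  have [a [t st]] := edges_total (g := G) s.
  pose Q (e : vertex G * A * vertex G) := (e \in edges G) && (e.1.1 == s).
  have Q0 : Q (s, a, t) by rewrite /Q st eqxx.
  case: (s \in vmax G).
    have [e /andP[eG /eqP es] me] := @arg_maxnP _ _ Q r Q0; exists e; split=> // e' e'G e's.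
    by apply: me; rewrite /Q e'G -e's eqxx.
  have [e /andP[eG /eqP es] me] := @arg_minnP _ _ Q r Q0; exists e; split=> // e' e'G e's.
  by apply: me; rewrite /Q e'G -e's eqxx.
exists f; split=> [s|e eG es|e eG]; first by case: (Pf s).
  by case: (Pf (source e)) => _ _ /(_ e eG erefl); rewrite es.
rewrite vmin_vmaxN => /negPf es.
by case: (Pf (source e)) => _ _ /(_ e eG erefl); rewrite es.
Qed.

End PositionalStrategies.

(** * A continuous payoff that reads two letters *)

Lemma two_letter_continuous (A : finType) (R : realType) (f : word A -> R) :
  (forall u v : word A, u 0%N = v 0%N -> u 1%N = v 1%N -> f u = f v) ->
  continuous f.
Proof.
move=> f2 u.
have near_coord i : \forall v \near u, (v : word A) i = u i.
  have /(_ [set x | x = u i]) := @proj_continuous nat (fun=> discrete_topology A) i u.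
  by apply; apply: discrete_set1.
have near_f : \forall v \near u, f v = f u.
  by near=> v; apply: f2; near: v; exact: near_coord.
exact: (@cvg_near_cst (word A) R (f u) f (nbhs u) _ near_f).
Unshelve. all: by end_near. Qed.

Definition letter : finType := (bool + 'I_3)%type.

(* The truncation at 2 keeps the values of [step (inl b)] at most 5, where [rank]
   vanishes: the composite of two steps is then constant, so that [phi] depends
   on two letters only. *)
Definition rank (v : nat) : nat := minn (v - 5) 2.

Definition step (l : letter) (v : nat) : nat :=
  match l with
  | inl b => 2 * rank v + (b (+) odd (rank v))
  | inr i => 5 + i
  end.

(** Distinct ranks put the terms [2 * rank] at least 2 apart, which the parity bit cannot
    reverse. *)
Lemma step_homo l v w : (rank v <= rank w)%N -> (step l v <= step l w)%N.
Proof.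
case: l => //= b; rewrite leq_eqVlt => /predU1P[->//|lt].
by case: (_ (+) _); case: (_ (+) _); lia.
Qed.

Lemma rank_homo v w : (v <= w)%N -> (rank v <= rank w)%N.
Proof. rewrite /rank; lia. Qed.

Lemma rank_step l v w : rank (step l v) = rank (step l w).
Proof.
case: l => //= b; rewrite /rank.
by case: (_ (+) _); case: (_ (+) _); lia.
Qed.

Lemma step_le7 l v : (step l v <= 7)%N.
Proof.
case: l => [b|i] /=; last by case: i => i /=; lia.
by rewrite /rank; case: (_ (+) _); lia.
Qed.

Section Payoff.
Variable R : realType.

Definition phi_fun (u : word letter) : R := (step (u 0%N) (step (u 1%N) 0))%:R.

Lemma phi_bounded : bounded_fun phi_fun.
Proof.
exists 7; split=> // M M7 u _; apply: le_trans (ltW M7).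
by rewrite ger0_norm ?ler0n// ler_nat step_le7.
Qed.

Definition phi : payoff letter R := Payoff phi_bounded.

Lemma phi_continuous : continuous (phi : word letter -> R).
Proof. by apply: two_letter_continuous => u v uv0 uv1; rewrite /= /phi_fun uv0 uv1. Qed.

End Payoff.

(** * Bellman equations and positional determinacy *)

Lemma step_rank l v w : rank v = rank w -> step l v = step l w.
Proof. by move=> rvw; apply/eqP; rewrite eqn_leq !step_homo ?rvw. Qed.

Lemma value_exists (G : game_graph letter) :
  exists f (V : vertex G -> nat), [/\ valid_choice f,
    forall s, V s = step (lab (f s)) (V (target (f s))),
    forall e, e \in edges G -> source e \in vmax G ->
      (step (lab e) (V (target e)) <= V (source e))%N &
    forall e, e \in edges G -> source e \in vmin G ->
      (V (source e) <= step (lab e) (V (target e)))%N].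
Proof.
pose r (v : vertex G -> nat) (e : @edge letter G) := step (lab e) (v (target e)).
(* At a vertex of Max compare [f s] and [g s] under [w], at a vertex of Min under [v]; [rank_step]
   allows the change of valuation. Hence [f] need only be optimal for Min and [g] for Max. *)
have rank_best v w f g s : valid_choice f -> valid_choice g ->
    (forall e, e \in edges G -> source e \in vmin G ->
      (r v (f (source e)) <= r v e)%N) ->
    (forall e, e \in edges G -> source e \in vmax G ->
      (r w e <= r w (g (source e)))%N) ->
    (rank (r v (f s)) <= rank (r w (g s)))%N.
  move=> vf vg bf bg; have [fE fs] := vf s; have [gE gs] := vg s.
  have := bg _ fE; have := bf _ gE; rewrite fs gs vmin_vmaxN.
  case: (s \in vmax G) => [_ /(_ isT) le_r|/(_ isT) le_r _].
    by rewrite /r (rank_step _ _ (w (target (f s)))) rank_homo.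
  by rewrite [leqRHS](rank_step _ _ (v (target (g s)))) rank_homo.
(* Two rounds of value iteration suffice, since the rank of a best edge does not
   depend on the valuation of its target. *)
have [f0 [vf0 max0 min0]] := best_edges (r (fun=> 0%N)).
pose V1 s := r (fun=> 0%N) (f0 s).
have [f [vf max1 min1]] := best_edges (r V1).
pose V s := r V1 (f s).
(* [V1] and [V] may differ, but [rank_best] in both directions gives them equal ranks, which is all
   that [step] sees. So [V] satisfies its own Bellman equations. *)
have step_V l s : step l (V1 s) = step l (V s).
  by apply: step_rank; apply/eqP; rewrite eqn_leq !rank_best.
exists f, V; split=> //.
- by move=> s; rewrite -step_V.
- by move=> e eE es; rewrite -step_V; exact: max1.
- by move=> e eE es; rewrite -step_V; exact: min1.
Qed.

Lemma phi_positionally_determined (R : realType) : positionally_determined (phi R).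
Proof.
move=> G; have [f [V [vf Vf Vmax Vmin]]] := value_exists G.
exists (positional_strategy _ vf), (positional_strategy _ vf).
split; [exact: positional_strategyP..|].
apply/equilibriumP => s P Q /Cons_positional[ipP Ps cP] /Cons_positional[ipQ Qs cQ].
have leP n : (step (lab (P n)) (V (source (P n.+1))) <= V (source (P n)))%N.
  have [PE <-] := ipP n; have := vmin_vmaxN (source (P n)).
  case: (boolP (_ \in vmax G)) => [/(Vmax _ PE)//|_ /cP Pn].
  by rewrite [leqRHS]Vf -Pn.
have leQ n : (V (source (Q n)) <= step (lab (Q n)) (V (source (Q n.+1))))%N.
  have [QE <-] := ipQ n; have := vmin_vmaxN (source (Q n)).
  case: (boolP (_ \in vmax G)) => [/cQ Qn _|_ /(Vmin _ QE)//].
  by rewrite [leqLHS]Vf -Qn.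
(* [V s] separates the two payoffs. Unfolding two edges leaves [V] at the third vertex where the
   payoff has 0; [rank_step] makes this harmless. *)
rewrite ler_nat (@leq_trans (V s))//.
  rewrite -Ps; apply: (leq_trans _ (leP 0%N)); apply: step_homo.
  by rewrite (rank_step _ _ (V (source (P 2%N)))); exact: rank_homo (leP 1%N).
rewrite -Qs; apply: leq_trans (leQ 0%N) _; apply: step_homo.
by rewrite [leqRHS](rank_step _ _ (V (source (Q 2%N)))); exact: rank_homo (leQ 1%N).
Qed.

(** * A one-player graph that compares words *)

(* At [inl i] the player prefixes [(inr i)^w] with one of the letters [inl b]; at
   [inr (i, j)] they choose between [(inr i)^w] and [(inr j)^w], and [inr (i, i)]
   is the sink where [(inr i)^w] is played. *)
Definition position : finType := ('I_3 + 'I_3 * 'I_3)%type.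

Definition out (v : position) (b : bool) : letter * 'I_3 :=
  match v with
  | inl i => (inl b, i)
  | inr (i, j) => let k := if b then i else j in (inr k, k)
  end.

Definition arrow (v : position) (b : bool) : position * letter * position :=
  (v, (out v b).1, inr ((out v b).2, (out v b).2)).

Definition gadget : game_graph letter.
Proof.
refine (@GameGraph letter position finset.setT finset.set0
  [set arrow vb.1 vb.2 | vb : position * bool] _ _ _).
- by rewrite finset.setU0.
- by rewrite finset.setI0.
- move=> v; exists (out v true).1, (inr ((out v true).2, (out v true).2)).
  by apply/imsetP; exists (v, true).
Defined.

Definition gadget_word (v : position) (b : bool) : word letter :=
  fun n => if n is 0 then (out v b).1 else inr (out v b).2.

Lemma gadget_edge (e : @edge letter gadget) :
  e \in edges gadget -> exists b, e = arrow (source e) b.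
Proof. by case/imsetP => -[v b] _ ->; exists b. Qed.

(** The first edge leads to a sink [inr (k, k)], where both arrows are the same loop. *)
Lemma gadget_lab_word (P : nat -> @edge letter gadget) v b :
  is_ipath P -> P 0%N = arrow v b -> lab_word P = gadget_word v b.
Proof.
move=> ipP P0; pose k := (out v b).2.
have PS n : P n.+1 = (inr (k, k), inr k, inr (k, k)).
  have tP : target (P n) = inr (k, k).
    elim: n => [|n IH]; first by rewrite P0.
    have [PE _] := ipP n.+1; have [c ->] := gadget_edge PE.
    by rewrite -(ipP n).2 IH /target /=; case: c.
  have [PE _] := ipP n.+1; have [c ->] := gadget_edge PE.
  by rewrite -(ipP n).2 tP /arrow /=; case: c.
apply/funext => -[|n]; first by rewrite /lab_word P0.
by rewrite /lab_word PS.
Qed.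

Definition gadget_choice (beta : position -> bool) (v : vertex gadget) :
  @edge letter gadget := arrow v (beta v).

Lemma gadget_choice_valid beta : valid_choice (gadget_choice beta).
Proof. by move=> v; split=> //; apply/imsetP; exists (v, beta v). Qed.

Lemma gadget_reduces (R : realType) (chi psi : payoff letter R) :
  positionally_reduces chi psi gadget -> forall v b b',
  psi (gadget_word v b) <= psi (gadget_word v b') ->
  chi (gadget_word v b) <= chi (gadget_word v b').
Proof.
move=> red v b b'; case: (eqVneq b b') => [->//|neq_b psi_le].
(* A choice optimal for [psi] everywhere, with a possible tie at [v] resolved in favour of [b']. *)
pose beta u := if u == v then b' else psi (gadget_word u false) <= psi (gadget_word u true).
have beta_best u c : psi (gadget_word u c) <= psi (gadget_word u (beta u)).
  rewrite /beta; case: eqP => [->|_];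
    first by case: (eqVneq c b') => [->//|]; case: b psi_le neq_b; case: (b'); case: c.
  by case: (lerP _ (psi (gadget_word u true))); case: c => // /ltW.
pose vf := gadget_choice_valid beta.
have max_word s Q : Cons s (positional_strategy (vmax gadget) vf) Q ->
    lab_word Q = gadget_word s (beta s).
  case/Cons_positional=> ipQ Qs cQ; apply: gadget_lab_word => //.
  by rewrite cQ ?inE// Qs.
have eq_psi : equilibrium psi (positional_strategy (vmax gadget) vf)
    (positional_strategy (vmin gadget) vf).
  apply/equilibriumP => s P Q /Cons_positional[ipP Ps _] /max_word ->.
  have [c Pc] := gadget_edge (ipP 0%N).1.
  by rewrite (gadget_lab_word ipP Pc) Ps.
have /equilibriumP eq_chi := red _ _ (positional_strategyP vf)
  (positional_strategyP vf) eq_psi.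
(* Min owns no vertex, so the play that chooses [b] is also consistent with Min's strategy and may
   be compared with the one that chooses [b']. *)
have vg := gadget_choice_valid (fun=> b).
have pQ := play_Cons (vmax gadget) vf v.
have [ipP Ps cP] := (Cons_positional _ _ _ _).1 (play_Cons (vmax gadget) vg v).
have := eq_chi v _ _ _ pQ; rewrite (max_word _ _ pQ) /beta eqxx.
rewrite -(gadget_lab_word ipP (v := v) (b := b)) //; apply.
by apply/Cons_positional; split=> // n; rewrite inE.
Qed.

(** * Affine action of letters and the contradiction *)

Lemma multi_discounted_cons (A : finType) (R : realType) (psi : payoff A R)
    (lam w : A -> R) :
  (forall u : word A,
     series (fun n => (\prod_(i < n) lam (u i)) * w (u n)) @ \oo --> psi u) ->
  forall a (u : word A),
  psi (fun n => if n is m.+1 then u m else a) = w a + lam a * psi u.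
Proof.
move=> psiE a u; set au := (X in psi X).
pose S (v : word A) := series (fun n => (\prod_(i < n) lam (v i)) * w (v n)).
(* Every term after the first contains the factor [lam a]; the claim is the limit of this
   identity. *)
have S_au n : S au n.+1 = w a + lam a * S u n.
  rewrite /S /series /= big_nat_recl// big_ord0 mul1r mulr_sumr.
  by congr (_ + _); apply: eq_bigr => i _; rewrite big_ord_recl mulrA.
have cvg_au : S au @ \oo --> psi au by exact: psiE.
rewrite -cvg_shiftS in cvg_au.
rewrite -(cvg_lim (@Rhausdorff R) cvg_au); apply: cvg_lim; first exact: Rhausdorff.
under eq_fun do rewrite S_au.
by apply: cvgD; [exact: cvg_cst | apply: cvgM; [exact: cvg_cst | exact: psiE]].
Qed.

Theorem proposition6p7 (R : realType) :
  exists (A : finType) (phi : payoff A R) (G : game_graph A),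
    continuous (phi : word A -> R) /\
    positionally_determined phi /\
    ~ (exists psi : payoff A R,
         multi_discounted psi /\ positionally_reduces phi psi G).
Proof.
exists letter, (phi R), gadget; split; first exact: phi_continuous.
split; first exact: phi_positionally_determined.
case=> psi [[lam [w [_ /multi_discounted_cons psiE]]] red].
have psi_lt v b b' : (phi R) (gadget_word v b') < (phi R) (gadget_word v b) ->
    psi (gadget_word v b') < psi (gadget_word v b).
  by rewrite !ltNge; apply/contra/gadget_reduces.
pose y i := psi (fun=> inr i).
have psi_inl i b : psi (gadget_word (inl i) b) = w (inl b) + lam (inl b) * y i.
  rewrite /y -psiE; congr (psi _); by apply/funext => -[].
have psi_inr i j b : psi (gadget_word (inr (i, j)) b) = y (if b then i else j).
  congr (psi _); by apply/funext => -[].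
have y_lt (i j : 'I_3) : (i < j)%N -> y i < y j.
  move=> ij; have := @psi_lt (inr (j, i)) true false; rewrite !psi_inr; apply.
  by rewrite ltr_nat /= ltn_add2l.
have y01 := y_lt (inord 0) (inord 1).
have y12 := y_lt (inord 1) (inord 2).
(* On the values 5, 6, 7 [step (inl true)] gives 1, 2, 5 and [step (inl false)] gives 0, 3, 4. *)
have := @psi_lt (inl (inord 0)) true false.
have := @psi_lt (inl (inord 1)) false true.
have := @psi_lt (inl (inord 2)) true false.
rewrite !psi_inl /= /phi_fun /gadget_word /= !ltr_nat.
move: y01 y12; rewrite !inordK// => /(_ isT) y01 /(_ isT) y12 /(_ isT) h2 /(_ isT) h1 /(_ isT) h0.
(* The slope [lam (inl true) - lam (inl false)] would be negative by [y01], [h0], [h1] and positive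
   by [y12], [h1], [h2]. *)
nra.
Qed.
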